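(* Let $q$ be a prime power, let $k\ge 2$ be an integer and put $N=q^{k-1}+\cdots+q+1$. Suppose that $L,M\in\mathbb{F}_{q^k}[x]$ and $\beta\in\mu_N$ are such that $M(x)^q=\beta x^{-\deg(L)}L(x)$ for every $x\in\mu_N$. Then the polynomial $x^{\deg(L)+kN}M(x^{q-1})$ permutes $\mathbb{F}_{q^k}$ if and only if $\gcd(\deg(L)+kN,\,q-1)=1$ and $L/M$ permutes $\mu_N$.
   Context: $\mu_N=\{x\in\mathbb{F}_{q^k}: x^N=1\}$. A polynomial permutes $\mathbb{F}_{q^k}$ if the induced map $\mathbb{F}_{q^k}\to\mathbb{F}_{q^k}$ is a bijection. ''$L/M$ permutes $\mu_N$'' means that $M$ has no root in $\mu_N$ and $x\mapsto L(x)/M(x)$ is a bijection of $\mu_N$ onto itself. *)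

(* Defs.v *)
From mathcomp Require Import all_boot all_order all_algebra.

Set Implicit Arguments.
Unset Strict Implicit.
Unset Printing Implicit Defensive.

Import GRing.Theory.
Local Open Scope ring_scope.

Definition prime_power (q : nat) : Prop :=
  exists p n : nat, [/\ prime p, (0 < n)%N & q = (p ^ n)%N].

Definition mu (F : finFieldType) (N : nat) : {set F} := [set x | x ^+ N == 1].

(* The junk value 0 is used for the degree of the zero polynomial. *)
Definition deg (F : finFieldType) (P : {poly F}) : nat := (size P).-1.

Definition permutes_field (F : finFieldType) (P : {poly F}) : Prop :=
  bijective (fun x : F => P.[x]).

(* The image equation says both that the map sends mu F N into itself and that
   it is onto. *)
Definition quotient_permutes_mu (F : finFieldType) (N : nat) (L M : {poly F}) :
    Prop :=
  [/\ forall x, x \in mu F N -> ~~ root M x,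
      {in mu F N &, injective (fun x => L.[x] / M.[x])}
    & [set L.[x] / M.[x] | x in mu F N] = mu F N].

(* Main.v *)
(** Put [P = x^r h(x^m)] with [m N = #|F| - 1].  The [m]-th power map sends
    [F^*] onto [mu_N] and intertwines [P] with [g(x) = x^r h(x)^m]; its fibres
    are the cosets of [mu_m], on which [P] acts as a multiple of [x^r].  Hence
    [P] permutes [F] iff [gcd(r, m) = 1], [h] has no root in [mu_N] and [g]
    permutes [mu_N].  For [m = q - 1], [r = deg L + k N] and [h = M] the
    hypothesis on [L] and [M] says that [g = beta L / M] on [mu_N]. *)

Require Import Defs.
From mathcomp Require Import all_boot all_order all_algebra.
From mathcomp Require Import cyclic finfield.

Set Implicit Arguments.
Unset Strict Implicit.
Unset Printing Implicit Defensive.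

Import GRing.Theory.
Local Open Scope ring_scope.

Lemma muP (F : finFieldType) (N : nat) (x : F) :
  reflect (x ^+ N = 1) (x \in mu F N).
Proof. by rewrite inE; apply: eqP. Qed.

Lemma mu_neq0 (F : finFieldType) (N : nat) (x : F) :
  (0 < N)%N -> x \in mu F N -> x != 0.
Proof.
move=> N_gt0 /muP xN; apply/eqP => x0; move: xN; rewrite x0 expr0n.
by case: N N_gt0 => //= N _ /esym/eqP; rewrite oner_eq0.
Qed.

Lemma mulV_mu (F : finFieldType) (N : nat) (x y : F) :
  x \in mu F N -> y \in mu F N -> x^-1 * y \in mu F N.
Proof.
move=> /muP x1 /muP y1; apply/muP.
by rewrite exprMn exprVn x1 y1 invr1 mul1r.
Qed.

Lemma mul_mu (F : finFieldType) (N : nat) (x y : F) :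
  x \in mu F N -> y \in mu F N -> x * y \in mu F N.
Proof. by move=> /muP x1 /muP y1; apply/muP; rewrite exprMn x1 y1 mul1r. Qed.

Lemma finField_card_pred_gt0 (F : finFieldType) : (0 < #|F|.-1)%N.
Proof. by rewrite -subn1 subn_gt0 finNzRing_gt1. Qed.

Lemma finField_unity (F : finFieldType) (x : F) : x != 0 -> x ^+ #|F|.-1 = 1.
Proof.
move=> x0; apply: (mulfI x0); rewrite -exprS mulr1 prednK ?expf_card //.
exact: ltnW (finNzRing_gt1 F).
Qed.

Lemma finField_prim_root (F : finFieldType) :
  exists w : F, (#|F|.-1).-primitive_root w.
Proof.
have: has (#|F|.-1).-primitive_root (enum [set~ (0 : F)]).
  apply: has_prim_root; first exact: finField_card_pred_gt0.
  - apply/allP => x; rewrite mem_enum !inE => x0.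
    by apply/unity_rootP; rewrite finField_unity.
  - exact: enum_uniq.
  - by rewrite -cardE cardsC1.
by case/hasP=> w _ w_prim; exists w.
Qed.

(** Write [y] as [w ^+ i] for a generator [w] of the cyclic group of units: [y ^+ N = 1] forces
    [m * N] to divide [i * N], hence [m] to divide [i]. *)
Lemma mu_expP (F : finFieldType) (m N : nat) (y : F) :
  (m * N)%N = #|F|.-1 -> y \in mu F N -> exists2 x, x != 0 & y = x ^+ m.
Proof.
move=> mN /muP yN; have [w w_prim] := finField_prim_root F.
have mN_gt0 : (0 < m * N)%N by rewrite mN finField_card_pred_gt0.
have N_gt0 : (0 < N)%N by move: mN_gt0; rewrite muln_gt0 => /andP[].
have w0 : w != 0.
  by apply: (mu_neq0 (finField_card_pred_gt0 F)); apply/muP/prim_expr_order.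
have y1 : y ^+ #|F|.-1 = 1 by rewrite -mN mulnC exprM yN expr1n.
have [i yE] := prim_rootP w_prim y1.
have: (m %| i)%N.
  rewrite -(dvdn_pmul2r N_gt0) mN (prim_order_dvd w_prim).
  by rewrite exprM -yE yN.
case/dvdnP=> j iE; exists (w ^+ j); first exact: expf_neq0.
by rewrite yE iE exprM.
Qed.

(** Bézout over the naturals, in the subtraction-free form [u * r = v * m + gcdn r m]. *)
Lemma exprn_gcd1 (F : fieldType) (r m : nat) (x : F) : (0 < r)%N ->
  x ^+ r = 1 -> x ^+ m = 1 -> x ^+ gcdn r m = 1.
Proof.
move=> r_gt0 xr xm; have [u v uE _] := egcdnP m r_gt0.
have: x ^+ (u * r) = x ^+ (v * m + gcdn r m) by rewrite uE.
by rewrite exprD mulnC exprM xr mulnC exprM xm !expr1n mul1r => <-.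
Qed.

(** An image equation suffices to express that the induced map permutes [mu F N], since a surjective
    self-map of a finite set is injective. Positivity of [r] makes the polynomial fix 0, so that 0
    can be treated apart from the units. *)
Theorem permutes_field_expM (F : finFieldType) (r m N : nat) (h : {poly F}) :
  (0 < r)%N -> (m * N)%N = #|F|.-1 ->
  permutes_field ('X^r * (h \Po 'X^m)) <->
  [/\ gcdn r m = 1%N, forall x, x \in mu F N -> ~~ root h x
    & [set x ^+ r * h.[x] ^+ m | x in mu F N] = mu F N].
Proof.
move=> r_gt0 mN; set P := _ * _.
have PE x : P.[x] = x ^+ r * h.[x ^+ m].
  by rewrite /P hornerM horner_comp !hornerXn.
have P0 : P.[0] = 0 by rewrite PE expr0n eqn0Ngt r_gt0 mul0r.
have PmE x : P.[x] ^+ m = (x ^+ m) ^+ r * h.[x ^+ m] ^+ m.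
  by rewrite PE exprMn exprAC.
have pow_mu x : x != 0 -> x ^+ m \in mu F N.
  by move=> x0; apply/muP; rewrite -exprM mN finField_unity.
split.
- move=> P_bij; have P_inj := bij_inj P_bij.
  have P_neq0 x : x != 0 -> P.[x] != 0.
    by move=> x0; rewrite -P0; apply: contraNneq x0 => /P_inj ->.
  split.
  + have [w w_prim] := finField_prim_root F.
    (* The element [w ^+ e] has order [gcdn r m], so its [r]-th and [m]-th powers are 1 and [P]
       takes the same value there as at 1. Injectivity then makes this order 1. *)
    have /dvdnP[e eE] : (gcdn r m %| #|F|.-1)%N.
      by rewrite -mN dvdn_mulr // dvdn_gcdr.
    have e_gt0 : (0 < e)%N.
      by have := finField_card_pred_gt0 F; rewrite eE muln_gt0 => /andP[].
    have we_gcd : (w ^+ e) ^+ gcdn r m = 1.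
      by rewrite -exprM -eE prim_expr_order.
    have we_dvd n : (gcdn r m %| n)%N -> (w ^+ e) ^+ n = 1.
      by case/dvdnP=> i ->; rewrite mulnC exprM we_gcd expr1n.
    have : w ^+ e = 1.
      apply: P_inj => /=.
      by rewrite !PE !we_dvd ?dvdn_gcdl ?dvdn_gcdr // !expr1n.
    move/eqP; rewrite -(prim_order_dvd w_prim) eE.
    by rewrite -{2}(muln1 e) dvdn_pmul2l // dvdn1 => /eqP.
  + move=> y /(mu_expP mN)[x x0 ->]; rewrite /root.
    by have := P_neq0 x x0; rewrite PE mulf_eq0 negb_or => /andP[].
  + apply/setP => y; apply/imsetP/idP.
      case=> x /(mu_expP mN)[u u0 ->] ->.
      by rewrite -PmE pow_mu // P_neq0.
    (* A preimage of [u ^+ m] is the [m]-th power of the preimage of [u] under [P]. *)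
    case/(mu_expP mN)=> u u0 ->; have [P' _ P'K] := P_bij.
    have x0 : P' u != 0 by apply: contraNneq u0 => x0; rewrite -(P'K u) x0 P0.
    by exists (P' u ^+ m); rewrite ?pow_mu // -PmE P'K.
- case=> gcd1 h_neq0 g_im.
  have /imset_injP g_inj : #|[set x ^+ r * h.[x] ^+ m | x in mu F N]| == #|mu F N|.
    by rewrite g_im.
  have P_neq0 x : x != 0 -> P.[x] != 0.
    by move=> x0; rewrite PE mulf_neq0 ?expf_neq0 //; apply: h_neq0 (pow_mu x x0).
  apply: injF_bij => x y /= Pxy.
  have [x0|x0] := eqVneq x 0.
    have [->//|/P_neq0] := eqVneq y 0.
    by rewrite -Pxy x0 P0 eqxx.
  have [y0|y0] := eqVneq y 0.
    by have := P_neq0 x x0; rewrite Pxy y0 P0 eqxx.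
  (* Equal values of [P] have equal [m]-th powers, which are the values of the induced map at
     [x ^+ m] and [y ^+ m]. Once these two agree, the common nonzero factor of [h] cancels and
     leaves [x ^+ r = y ^+ r]. *)
  have xym : x ^+ m = y ^+ m.
    by apply: g_inj; rewrite ?pow_mu // -!PmE Pxy.
  have xyr : x ^+ r = y ^+ r.
    move: Pxy; rewrite !PE xym; apply: mulIf; exact: h_neq0 (pow_mu y y0).
  have xy_exp n : x ^+ n = y ^+ n -> (x / y) ^+ n = 1.
    by move=> xyn; rewrite exprMn exprVn xyn divff // expf_neq0.
  have := exprn_gcd1 r_gt0 (xy_exp _ xyr) (xy_exp _ xym).
  by rewrite gcd1 expr1 => /(canRL (divfK y0)); rewrite mul1r.
Qed.

Lemma prime_power_gt1 (q : nat) : prime_power q -> (1 < q)%N.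
Proof.
case=> p [n [p_prime n_gt0 ->]].
by rewrite -(exp1n n) ltn_exp2r // prime_gt1.
Qed.

(** Multiplication by [beta] permutes the group [mu F N], so [g] and [L / M] are onto it together.
    Injectivity of [L / M] then follows by counting. *)
Lemma quotient_permutes_muE (F : finFieldType) (N : nat) (L M : {poly F})
    (g : F -> F) (beta : F) : (0 < N)%N -> beta \in mu F N ->
  (forall x, x \in mu F N -> ~~ root M x -> g x = beta * (L.[x] / M.[x])) ->
  quotient_permutes_mu N L M <->
  (forall x, x \in mu F N -> ~~ root M x) /\ [set g x | x in mu F N] = mu F N.
Proof.
move=> N_gt0 beta_mu gE; have beta0 := mu_neq0 N_gt0 beta_mu.
split=> [[M_neq0 _ LM_im]|[M_neq0 g_im]].
  split=> //; apply/setP => y; apply/imsetP/idP => [[x x_mu ->]|y_mu].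
    rewrite gE ?M_neq0 //; apply: mul_mu => //.
    by rewrite -LM_im; apply/imsetP; exists x.
  have := mulV_mu beta_mu y_mu; rewrite -{1}LM_im.
  case/imsetP=> x x_mu xE; exists x => //.
  by rewrite gE ?M_neq0 // -xE mulVKf.
have LM_im : [set L.[x] / M.[x] | x in mu F N] = mu F N.
  apply/setP => y; apply/imsetP/idP => [[x x_mu ->]|y_mu].
    rewrite -(mulKf beta0 (_ / _)) -gE ?M_neq0 // mulV_mu //.
    by rewrite -g_im imset_f.
  have := mul_mu beta_mu y_mu; rewrite -{1}g_im.
  case/imsetP=> x x_mu; rewrite gE ?M_neq0 // => /(mulfI beta0) ->.
  by exists x.
by split=> //; apply/imset_injP; rewrite LM_im.
Qed.

Theorem theorem4p1 (q k N : nat) (F : finFieldType)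
    (q_prime_power : prime_power q) (k_ge2 : (2 <= k)%N)
    (N_def : N = (\sum_(i < k) q ^ i)%N) (cardF : #|F| = (q ^ k)%N)
    (L M : {poly F}) (beta : F) (beta_mu : beta \in mu F N)
    (LM : forall x : F, x \in mu F N ->
       M.[x] ^+ q = beta * x ^- (deg L) * L.[x]) :
  permutes_field ('X^(deg L + k * N) * (M \Po 'X^(q - 1))) <->
  (gcdn (deg L + k * N) (q - 1) = 1%N /\ quotient_permutes_mu N L M).
Proof.
have q_gt1 := prime_power_gt1 q_prime_power.
(* [N] is a geometric sum. *)
have qN : ((q - 1) * N)%N = #|F|.-1 by rewrite cardF predn_exp N_def subn1.
have N_gt0 : (0 < N)%N.
  by have := finField_card_pred_gt0 F; rewrite -qN muln_gt0 => /andP[].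
have r_gt0 : (0 < deg L + k * N)%N.
  by rewrite addn_gt0 muln_gt0 N_gt0 (ltnW k_ge2) orbT.
have gE x : x \in mu F N -> ~~ root M x ->
    x ^+ (deg L + k * N) * M.[x] ^+ (q - 1) = beta * (L.[x] / M.[x]).
  move=> x_mu Mx0; have x0 := mu_neq0 N_gt0 x_mu.
  (* Multiplying by [M.[x]] produces the power [M.[x] ^+ q] of the hypothesis; then [x ^+ (k * N)]
     is 1 and [x ^+ deg L] cancels the negative power of [x]. *)
  apply: (mulIf Mx0); rewrite -!mulrA -exprSr subn1 prednK ?(ltnW q_gt1) //.
  rewrite LM // mulVf // mulr1 exprD mulnC exprM (muP _ _ x_mu) expr1n mulr1.
  by rewrite mulrA [_ * (beta * _)]mulrCA divff ?expf_neq0 // mulr1.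
have quotE := quotient_permutes_muE N_gt0 beta_mu gE.
split=> [/(permutes_field_expM M r_gt0 qN)[gcd1 M_neq0 g_im]|[gcd1 /quotE[M_neq0 g_im]]].
  by split=> //; apply/quotE.
exact/(permutes_field_expM M r_gt0 qN).
Qed.
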